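(* Let $n,p\ge 1$, let $0<\mu< L<\infty$, and let $f_1,\dots,f_n:\mathbb{R}^p\to\mathbb{R}$ be differentiable, $\mu$-strongly convex functions with $L$-Lipschitz continuous gradients. Let $x^*$ be the minimizer of $f=\frac1n\sum_{i=1}^n f_i$, let $\kappa=L/\mu$ and $\rho=(\kappa-1)/(\kappa+1)$. Let $(x^k)_{k\ge 0}$ be the sequence generated by the DIAG method from $x^0\in\mathbb{R}^p$ with stepsize $\epsilon=2/(\mu+L)$. Then for all $k\ge 1$, $$\|x^k-x^*\|\le a_0\gamma_0^k\|x^0-x^*\|,$$ where $\gamma_0$ is the unique root in the interval $[0,1)$ of the equation $$\gamma^{n+1}-\left(1+\frac{\rho}{n}\right)\gamma^n+\frac{\rho}{n}=0,$$ and $$a_0=\max_{i\in\{1,\dots,n\}}\rho\left(1-\frac{(i-1)(1-\rho)}{n}\right)\gamma_0^{-i}.$$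
   Context: $\|\cdot\|$ is the Euclidean norm. A differentiable $f_i$ is $\mu$-strongly convex if $(\nabla f_i(x)-\nabla f_i(y))^T(x-y)\ge \mu\|x-y\|^2$ for all $x,y\in\mathbb{R}^p$; its gradient is $L$-Lipschitz if $\|\nabla f_i(x)-\nabla f_i(y)\|\le L\|x-y\|$ for all $x,y\in\mathbb{R}^p$. DIAG (Double Incremental Aggregated Gradient) method with stepsize $\epsilon$: given $x^0\in\mathbb{R}^p$, set $y_1^0=\dots=y_n^0=x^0$. For $k=0,1,2,\dots$, let $i^k=(k \bmod n)+1$, compute $$x^{k+1}=\frac1n\sum_{i=1}^n y_i^k-\frac{\epsilon}{n}\sum_{i=1}^n\nabla f_i(y_i^k),$$ and set $y_{i^k}^{k+1}=x^{k+1}$ and $y_i^{k+1}=y_i^k$ for $i\ne i^k$. *)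

(* Defs.v *)
From mathcomp Require Export all_boot all_order all_algebra.
From mathcomp Require Export boolp classical_sets functions reals.
From mathcomp Require Export topology normedtype derive.

Set Implicit Arguments.
Unset Strict Implicit.
Unset Printing Implicit Defensive.

Import Order.TTheory GRing.Theory Num.Theory.
Import numFieldNormedType.Exports.

Local Open Scope ring_scope.

Definition dotp (R : realType) (p : nat) (u v : 'rV[R]_p) : R := (u *m v^T) 0 0.

(* The library norm `|u| on 'rV[R]_p is the sup norm, hence this definition;
   the two induce the same topology, so [differentiable] is unaffected. *)
Definition enorm (R : realType) (p : nat) (u : 'rV[R]_p) : R :=
  Num.sqrt (dotp u u).

Definition grad (R : realType) (p : nat) (f : 'rV[R]_p -> R) (x : 'rV[R]_p) :
    'rV[R]_p :=
  \row_(j < p) 'D_(delta_mx 0 j) f x.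

Definition strongly_convex (R : realType) (p : nat) (mu : R)
    (f : 'rV[R]_p -> R) : Prop :=
  forall x y, mu * enorm (x - y) ^+ 2 <= dotp (grad f x - grad f y) (x - y).

Definition lipschitz_grad (R : realType) (p : nat) (L : R)
    (f : 'rV[R]_p -> R) : Prop :=
  forall x y, enorm (grad f x - grad f y) <= L * enorm (x - y).

Definition favg (R : realType) (n p : nat) (f : 'I_n -> 'rV[R]_p -> R)
    (x : 'rV[R]_p) : R :=
  n%:R^-1 * \sum_(i < n) f i x.

Definition is_minimizer (R : realType) (p : nat) (f : 'rV[R]_p -> R)
    (x : 'rV[R]_p) : Prop :=
  forall z, f x <= f z.

Definition diag_step (R : realType) (n p : nat) (eps : R)
    (f : 'I_n -> 'rV[R]_p -> R) (y : 'I_n -> 'rV[R]_p) : 'rV[R]_p :=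
  n%:R^-1 *: (\sum_(i < n) y i) - (eps / n%:R) *: (\sum_(i < n) grad (f i) (y i)).

(* The components are indexed from 0, so the one refreshed at step k is the
   one of index k %% n. *)
Fixpoint diag_y (R : realType) (n p : nat) (eps : R)
    (f : 'I_n -> 'rV[R]_p -> R) (x0 : 'rV[R]_p) (k : nat) :
    'I_n -> 'rV[R]_p :=
  if k is k'.+1 then
    let y := diag_y eps f x0 k' in
    fun i => if (i : nat) == (k' %% n)%N then diag_step eps f y else y i
  else fun=> x0.

Definition diag_x (R : realType) (n p : nat) (eps : R)
    (f : 'I_n -> 'rV[R]_p -> R) (x0 : 'rV[R]_p) (k : nat) : 'rV[R]_p :=
  if k is k'.+1 then diag_step eps f (diag_y eps f x0 k') else x0.

Definition rate_root (R : realType) (n : nat) (rho gamma : R) : Prop :=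
  [/\ 0 <= gamma, gamma < 1
    & gamma ^+ n.+1 - (1 + rho / n%:R) * gamma ^+ n + rho / n%:R = 0].

Definition a0_term (R : realType) (n : nat) (rho gamma : R) (i : nat) : R :=
  rho * (1 - (i%:R - 1) * (1 - rho) / n%:R) * gamma ^- i.

(* For n >= 1 the default value of the iterated maximum is one of its terms,
   so this is exactly the maximum over i = 1, ..., n. *)
Definition a0_max (R : realType) (n : nat) (rho gamma : R) : R :=
  \big[Num.max/a0_term n rho gamma 1]_(1 <= i < n.+1) a0_term n rho gamma i.

(* Main.v *)
Require Import Defs.
From mathcomp Require Import ring lra zify.

Import Order.TTheory GRing.Theory Num.Theory.
Import numFieldNormedType.Exports.

Local Open Scope ring_scope.

(** With eps = 2 / (mu + L), each map x |-> x - eps * grad (f i) x is a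
    rho-contraction: this is the strengthened cocoercivity of the gradient of
    a strongly convex function with Lipschitz gradient.  As the gradients at
    xstar sum to 0, the errors e k = |x k - xstar| therefore satisfy
    e (k + 1) <= rho / n * (sum of the n previous errors), where e 0 is
    repeated as long as some component has not been refreshed.  For k <= n
    this gives e k <= rho * (1 - (k - 1) * (1 - rho) / n) * e 0, and a0 is
    the least constant turning these bounds into a0 * gamma0 ^ k * e 0.
    Since gamma0 ^ n = rho / n * (1 + gamma0 + ... + gamma0 ^ (n - 1)), the
    recursion propagates the geometric bound to all k > n. *)

(** * Euclidean inner product and norm *)

Section Euclidean.
Context {R : realType} {p : nat}.
Implicit Types (u v w : 'rV[R]_p) (a : R).

Lemma dotpE u v : dotp u v = \sum_j u 0 j * v 0 j.
Proof. by rewrite /dotp mxE; apply: eq_bigr => j _; rewrite mxE. Qed.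

Lemma dotpC u v : dotp u v = dotp v u.
Proof. by rewrite !dotpE; apply: eq_bigr => j _; rewrite mulrC. Qed.

Lemma dotpDl u v w : dotp (u + v) w = dotp u w + dotp v w.
Proof. by rewrite /dotp mulmxDl mxE. Qed.

Lemma dotpDr u v w : dotp w (u + v) = dotp w u + dotp w v.
Proof. by rewrite dotpC dotpDl !(dotpC _ w). Qed.

Lemma dotpZl a u v : dotp (a *: u) v = a * dotp u v.
Proof. by rewrite /dotp -scalemxAl mxE. Qed.

Lemma dotpZr a u v : dotp u (a *: v) = a * dotp u v.
Proof. by rewrite dotpC dotpZl dotpC. Qed.

Lemma dotpNl u v : dotp (- u) v = - dotp u v.
Proof. by rewrite -scaleN1r dotpZl mulN1r. Qed.

Lemma dotpNr u v : dotp u (- v) = - dotp u v.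
Proof. by rewrite dotpC dotpNl dotpC. Qed.

Definition dotp_linE := (dotpDl, dotpDr, dotpNl, dotpNr, dotpZl, dotpZr).

Lemma dotp_ge0 u : 0 <= dotp u u.
Proof. by rewrite dotpE sumr_ge0 // => j _; rewrite -expr2 sqr_ge0. Qed.

Lemma dotp_eq0 u : (dotp u u == 0) = (u == 0).
Proof.
apply/idP/eqP => [|->]; last by rewrite /dotp mul0mx mxE.
rewrite dotpE psumr_eq0 => [/allP u0|j _]; last by rewrite -expr2 sqr_ge0.
apply/rowP => j; rewrite mxE; apply/eqP.
by have := u0 j (mem_index_enum _); rewrite mulf_eq0 orbb.
Qed.

Lemma enorm_ge0 u : 0 <= enorm u.
Proof. exact: sqrtr_ge0. Qed.

Lemma sqr_enorm u : enorm u ^+ 2 = dotp u u.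
Proof. by rewrite sqr_sqrtr // dotp_ge0. Qed.

Lemma enorm0 : enorm (0 : 'rV[R]_p) = 0.
Proof. by rewrite /enorm /dotp mul0mx mxE sqrtr0. Qed.

Lemma enormZ a u : 0 <= a -> enorm (a *: u) = a * enorm u.
Proof.
move=> a0; rewrite /enorm !dotp_linE mulrA -expr2 sqrtrM ?sqr_ge0 //.
by rewrite sqrtr_sqr ger0_norm.
Qed.

(** Cauchy-Schwarz: for nonzero [v], expand the square of [dotp v v *: u - dotp u v *: v] and divide
    by [dotp v v]. *)
Lemma dotp_le u v : dotp u v <= enorm u * enorm v.
Proof.
apply: le_trans (ler_norm _) _.
rewrite -ler_sqr ?nnegrE ?mulr_ge0 ?enorm_ge0 // real_normK ?num_real //.
rewrite exprMn !sqr_enorm.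
have [->|v0] := eqVneq v 0.
  by rewrite /dotp trmx0 !mulmx0 mxE expr0n mulr0.
have vv0 : 0 < dotp v v by rewrite lt_def dotp_eq0 v0 dotp_ge0.
have := dotp_ge0 (dotp v v *: u - dotp u v *: v).
rewrite !dotp_linE (dotpC v u) => h.
rewrite -subr_ge0 -(pmulr_rge0 _ vv0).
by apply: le_trans h _; rewrite le_eqVlt; apply/orP; left; apply/eqP; ring.
Qed.

Lemma enormD u v : enorm (u + v) <= enorm u + enorm v.
Proof.
rewrite -ler_sqr ?nnegrE ?addr_ge0 ?enorm_ge0 //.
rewrite sqrrD !sqr_enorm !dotp_linE (dotpC v u).
have := dotp_le u v; lra.
Qed.

Lemma enorm_sum (I : Type) (r : seq I) (P : pred I) (F : I -> 'rV[R]_p) :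
  enorm (\sum_(i <- r | P i) F i) <= \sum_(i <- r | P i) enorm (F i).
Proof.
elim/big_ind2: _ => [|u a v b ua vb|i _]; rewrite ?enorm0 //.
exact: le_trans (enormD _ _) (lerD ua vb).
Qed.

End Euclidean.

(** * Gradients, restriction to lines, and minimizers *)

Section Gradient.
Context {R : realType} {p : nat}.
Implicit Types (f : 'rV[R]_p -> R) (x v d : 'rV[R]_p).

Lemma derive_dotp f x v : differentiable f x -> 'D_v f x = dotp (grad f x) v.
Proof.
move=> df; rewrite deriveE // [in LHS](row_sum_delta v) linear_sum dotpE.
by apply: eq_bigr => j _; rewrite linearZ mxE deriveE // mulrC.
Qed.

Lemma is_derive_line f x v (t : R) : differentiable f (x + t *: v) ->
  is_derive t 1 (fun s : R => f (x + s *: v)) (dotp (grad f (x + t *: v)) v).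
Proof.
move=> df.
have E : (fun h : R => h^-1 *: (((fun s : R => f (x + s *: v)) \o shift t) (h *: 1)
   - f (x + t *: v))) =
  (fun h => h^-1 *: ((f \o shift (x + t *: v)) (h *: v) - f (x + t *: v))).
  apply/funext => h /=; congr (_ *: (f _ - _)).
  by rewrite scaler1 scalerDl addrC addrAC addrA.
apply: DeriveDef.
  by rewrite /derivable E; exact: diff_derivable.
by rewrite /derive E -derive_dotp.
Qed.

(** Mean value theorem on [0, 1] for [f] along the segment minus its linear part and
    [c / 2 * t ^+ 2]. The free [c] serves both quadratic bounds below, as [mu] or [L] times
    [dotp d d]. *)
Lemma bregman_MVT f x d (c : R) : (forall z, differentiable f z) ->
  exists2 t : R, 0 < t & f (x + d) - f x - dotp (grad f x) d - c / 2 =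
    dotp (grad f (x + t *: d) - grad f x) d - c * t.
Proof.
move=> df; pose b := dotp (grad f x) d.
pose g (t : R) := f (x + t *: d) - (b * t + c / 2 * t ^+ 2).
pose dg (t : R) := dotp (grad f (x + t *: d)) d - (b + c * t).
have g' (t : R) : is_derive t 1 g (dg t).
  have h1 := @is_derive_line f x d t (df _).
  pose q : {poly R} := b *: 'X + (c / 2) *: 'X^2.
  have h2 := is_derive_poly q t.
  have -> : g = (fun s : R => f (x + s *: d)) - horner q.
    apply/funext => s; rewrite -[RHS]/(f (x + s *: d) - q.[s]).
    by rewrite hornerD !hornerZ hornerX hornerXn.
  apply: is_derive_eq (is_deriveB h1 h2) _.
  rewrite /dg /q derivD !derivZ derivX derivXn.
  rewrite hornerD !hornerZ hornerMn hornerXn hornerC; congr (_ - _).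
  by field.
have [|t t01 E] := MVT ltr01 (fun t _ => g' t).
  by apply: derivable_within_continuous => t _; exact: (@ex_derive _ _ _ _ _ _ (dg t)).
exists t; first by move: t01; rewrite in_itv => /andP[].
move: E; rewrite /g /dg !scale1r !scale0r addr0 dotpDl dotpNl -/b; lra.
Qed.

(** The derivative of [favg f] at the minimizer in the direction of the gradient sum [G] itself is
    [dotp G G / n%:R]; it vanishes, hence so does [G]. *)
Lemma grad_favg_minimizer (n : nat) (f : 'I_n -> 'rV[R]_p -> R) x :
  (0 < n)%N -> (forall i z, differentiable (f i) z) ->
  is_minimizer (favg f) x -> \sum_(i < n) grad (f i) x = 0.
Proof.
move=> n0 df xmin; set G := \sum_(i < n) _.
pose h (i : 'I_n) (s : R) := f i (x + s *: G).
have h1 : is_derive (0 : R) 1 (n%:R^-1 \*: \sum_(i < n) h i)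
    (n%:R^-1 *: \sum_(i < n) dotp (grad (f i) (x + 0 *: G)) G).
  apply: is_deriveZ; apply: is_derive_sum => i; exact: is_derive_line.
have E : (n%:R^-1 \*: \sum_(i < n) h i) = fun s : R => favg f (x + s *: G).
  apply/funext => s.
  by rewrite -[LHS]/(n%:R^-1 * (\sum_(i < n) h i) s) fct_sumE.
have h2 : is_derive (0 : R) 1 (fun s : R => favg f (x + s *: G)) 0.
  apply: (@derive1_at_min _ _ (-1) 1).
  - lra.
  - move=> t _; rewrite -E.
    apply: (@ex_derive _ _ _ _ _ _
      (n%:R^-1 *: \sum_(i < n) dotp (grad (f i) (x + t *: G)) G)).
    apply: is_deriveZ; apply: is_derive_sum => i; exact: is_derive_line.
  - by rewrite in_itv /=; apply/andP; split; lra.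
  - by move=> t _; rewrite scale0r addr0.
rewrite E in h1.
have := derive_val (is_derive := h1); rewrite (derive_val (is_derive := h2)).
rewrite scale0r addr0.
have -> : \sum_(i < n) dotp (grad (f i) x) G = dotp G G.
  by rewrite [in RHS]/dotp {2}/G mulmx_suml summxE.
have n1 : n%:R^-1 != 0 :> R by rewrite invr_eq0 pnatr_eq0 -lt0n.
by move/esym/eqP; rewrite mulf_eq0 (negbTE n1) /= dotp_eq0 => /eqP.
Qed.

End Gradient.

(** * Strengthened cocoercivity and contraction of the gradient step *)

Section Contraction.
Context {R : realType} {p : nat}.
Variables (mu L : R) (f : 'rV[R]_p -> R).
Hypothesis mu_gt0 : 0 < mu.
Hypothesis mu_ltL : mu < L.
Hypothesis df : forall z, differentiable f z.
Hypothesis fsc : strongly_convex mu f.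
Hypothesis flip : lipschitz_grad L f.
Implicit Types x d : 'rV[R]_p.

(** Strong convexity between [x + t *: d] and [x], divided by [t], makes the right-hand side of
    [bregman_MVT] nonnegative. *)
Lemma strongly_convex_lower x d :
  f x + dotp (grad f x) d + mu / 2 * dotp d d <= f (x + d).
Proof.
have [t t0 E] := bregman_MVT f x d (mu * dotp d d) df.
have := fsc (x + t *: d) x.
rewrite [x + _ - x]addrAC subrr add0r sqr_enorm !dotpZl !dotpZr.
rewrite (_ : mu * _ = t * (mu * dotp d d * t)); last by ring.
rewrite ler_pM2l //; lra.
Qed.

(** Cauchy-Schwarz and the Lipschitz bound make the right-hand side of [bregman_MVT] nonpositive. *)
Lemma lipschitz_grad_upper x d :
  f (x + d) <= f x + dotp (grad f x) d + L / 2 * dotp d d.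
Proof.
have [t t0 E] := bregman_MVT f x d (L * dotp d d) df.
have := le_trans (dotp_le _ _) (ler_wpM2r (enorm_ge0 d) (flip (x + t *: d) x)).
rewrite [x + _ - x]addrAC subrr add0r enormZ ?(ltW t0) //.
rewrite -!sqr_enorm in E *; lra.
Qed.

(* Lower bound through the tangent at x and upper bound through the tangent
   at x + d are compared at x + d + w, where w minimizes the difference. *)
Lemma bregman_lower x d (g := grad f (x + d) - grad f x) :
  f x + dotp (grad f x) d + mu / 2 * dotp d d +
    dotp (g - mu *: d) (g - mu *: d) / (2 * (L - mu)) <= f (x + d).
Proof.
have M0 : 0 < L - mu by rewrite subr_gt0.
set r := g - mu *: d; pose w := - (L - mu)^-1 *: r.
have eg : grad f (x + d) = grad f x + r + mu *: d.
  by rewrite /r /g addrA !subrK addrC subrK.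
have := le_trans (strongly_convex_lower x (d + w))
  (eq_ind_r (fun z => f z <= _) (lipschitz_grad_upper (x + d) w) (addrA x d w)).
rewrite eg {}/w; clearbody r => {eg g}.
rewrite !dotp_linE (dotpC d r) -subr_ge0 => h; rewrite -subr_ge0.
apply: le_trans h _; rewrite le_eqVlt; apply/orP; left; apply/eqP.
by field; rewrite subr_eq0 gt_eqF.
Qed.

(** Add [bregman_lower] to its copy with [x] and [y] exchanged: the function values cancel, and
    multiplying by [L - mu] clears the denominator. *)
Lemma cocoercive x y :
  mu * L * dotp (x - y) (x - y) +
    dotp (grad f x - grad f y) (grad f x - grad f y) <=
  (mu + L) * dotp (grad f x - grad f y) (x - y).
Proof.
have M0 : 0 < L - mu by rewrite subr_gt0.
have := bregman_lower x (y - x); have := bregman_lower y (x - y).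
rewrite !subrKC -(opprB x y) -(opprB (grad f x)).
set d := x - y; set g := grad f x - grad f y.
have -> : grad f x = g + grad f y by rewrite subrK.
move: (grad f y) => b; clearbody d g => h1 h2.
have := lerD h1 h2; rewrite !dotp_linE (dotpC d g) -subr_ge0 => h.
rewrite -subr_ge0; apply: le_trans (mulr_ge0 (ltW M0) h) _.
rewrite le_eqVlt; apply/orP; left; apply/eqP.
by field; rewrite subr_eq0 gt_eqF.
Qed.

Lemma gradient_step_contraction x y :
  enorm ((x - (2 / (mu + L)) *: grad f x) - (y - (2 / (mu + L)) *: grad f y))
    <= (L - mu) / (L + mu) * enorm (x - y).
Proof.
have L0 : 0 < L := lt_trans mu_gt0 mu_ltL.
have S0 : 0 < mu + L by rewrite addr_gt0.
have rho0 : 0 <= (L - mu) / (L + mu).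
  by rewrite divr_ge0 ?subr_ge0 ?ltW // addrC.
rewrite -ler_sqr ?nnegrE ?enorm_ge0 ?(mulr_ge0 rho0) ?enorm_ge0 //.
rewrite exprMn !sqr_enorm.
have -> : x - (2 / (mu + L)) *: grad f x - (y - (2 / (mu + L)) *: grad f y) =
    (x - y) - (2 / (mu + L)) *: (grad f x - grad f y).
  by rewrite scalerBr !opprD !opprK addrACA.
have := cocoercive x y; set d := x - y; set g := grad f x - grad f y.
clearbody d g; rewrite !dotp_linE (dotpC d g) => h; rewrite -subr_ge0.
rewrite -subr_ge0 in h.
(* For this stepsize the gap between the squared sides is exactly this constant times the gap in
   [cocoercive]. *)
have c0 : 0 <= 4 / (mu + L) ^+ 2 by rewrite divr_ge0 // exprn_ge0 // ltW.
apply: le_trans (mulr_ge0 c0 h) _; rewrite le_eqVlt; apply/orP; left; apply/eqP.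
by field; rewrite gt_eqF // addrC gt_eqF.
Qed.

End Contraction.

(** * The rate equation and the recursion on the errors *)

Section RateRoot.
Context {R : realType}.
Variables (n : nat) (rho : R).
Hypothesis n_gt0 : (0 < n)%N.
Hypothesis rho_gt0 : 0 < rho.
Hypothesis rho_lt1 : rho < 1.

(** By the geometric sum, the polynomial is [x - 1] times the difference of the two sides of the
    second equation. *)
Lemma rate_root_sum (x : R) : x < 1 ->
  (x ^+ n.+1 - (1 + rho / n%:R) * x ^+ n + rho / n%:R == 0) =
  (x ^+ n == rho / n%:R * \sum_(j < n) x ^+ j).
Proof.
move=> x1; have {}x1 := lt_eqF x1; set c := rho / n%:R.
have -> : x ^+ n.+1 - (1 + c) * x ^+ n + c =
    (x - 1) * x ^+ n - c * (x ^+ n - 1) by rewrite exprS; ring.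
by rewrite subrX1 mulrCA -mulrBr mulf_eq0 !subr_eq0 x1.
Qed.

Let c_gt0 : 0 < rho / n%:R.
Proof. by rewrite divr_gt0 // ltr0n. Qed.

(** Existence is the intermediate value theorem for [q], negative at 0 and positive at 1. Positivity
    is recorded because [a0_term] divides by powers of the root. *)
Lemma exists_rate_root :
  exists2 gamma : R, unique (rate_root n rho) gamma & 0 < gamma.
Proof.
pose q : {poly R} := 'X^n - (rho / n%:R) *: \sum_(j < n) 'X^j.
have qE x : q.[x] = x ^+ n - rho / n%:R * \sum_(j < n) x ^+ j.
  by rewrite /q !hornerE horner_sum; congr (_ - _ * _);
    apply: eq_bigr => j _; rewrite hornerXn.
have q0 : q.[0] < 0.
  rewrite qE expr0n gtn_eqF // -(prednK n_gt0) big_ord_recl expr0 big1.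
    by rewrite addr0 mulr1 prednK // sub0r oppr_lt0.
  by move=> j _; rewrite expr0n.
have q1 : 0 < q.[1].
  rewrite qE expr1n (eq_bigr (fun=> 1)) => [|j _]; last by rewrite expr1n.
  rewrite sumr_const card_ord mulfVK ?subr_gt0 //.
  by rewrite pnatr_eq0 -lt0n.
have [|x /andP[x0 x1] /rootP qx] := @poly_ivt _ q 0 1 ler01.
  by rewrite !ltW.
have {}x0 : 0 < x.
  by rewrite lt_neqAle x0 andbT; apply/eqP => E; rewrite -E in qx; rewrite qx ltxx in q0.
have {}x1 : x < 1.
  by rewrite lt_neqAle x1 andbT; apply/eqP => E; rewrite E in qx; rewrite qx ltxx in q1.
(* Dividing by [gamma ^+ n] turns the equation into [1 = h gamma] with [h]
   strictly decreasing. *)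
pose h (y : R) := rho / n%:R * \sum_(j < n) y ^- (n - j).
have hE y : 0 < y -> y < 1 ->
    (y ^+ n.+1 - (1 + rho / n%:R) * y ^+ n + rho / n%:R == 0) = (h y == 1).
  move=> y0 y1; rewrite rate_root_sum //.
  have yn : y ^+ n != 0 by rewrite expf_neq0 ?gt_eqF.
  have <- : y ^+ n * h y = rho / n%:R * \sum_(j < n) y ^+ j.
    rewrite mulrCA mulr_sumr; congr (_ * _); apply: eq_bigr => j _.
    by rewrite expfB_cond ?gt_eqF ?(ltnW (ltn_ord j)) //= invf_div mulrC divfK.
  by rewrite -{1}[y ^+ n]mulr1 (inj_eq (mulfI yn)) eq_sym.
have h_decr (y z : R) : 0 < y -> y < z -> h z < h y.
  move=> y0 yz; rewrite ltr_pM2l //; apply: ltr_sum => [|j _].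
    by apply/hasP; exists (Ordinal n_gt0); rewrite ?mem_index_enum.
  have z0 := lt_trans y0 yz.
  by rewrite ltf_pV2 ?posrE ?exprn_gt0 // ltrXn2r // ?ltW // subn_eq0 -ltnNge.
exists x => //; split.
  split; rewrite ?ltW //.
  apply/eqP; rewrite rate_root_sum // -subr_eq0 -qE; exact/eqP.
move=> y [y0 y1 /eqP hy].
(* At 0 the equation would read [rho / n%:R = 0]. *)
have {}y0 : 0 < y.
  rewrite lt_neqAle y0 andbT; apply: contraTneq hy => <-.
  by rewrite !expr0n /= gtn_eqF // mulr0 subrr add0r gt_eqF.
move: hy; rewrite hE // => /eqP hy.
have /eqP hx : h x == 1.
  by rewrite -hE // rate_root_sum // -subr_eq0 -qE; exact/eqP.
case: (ltgtP x y) => // xy.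
- by have := h_decr _ _ x0 xy; rewrite hx hy ltxx.
- by have := h_decr _ _ y0 xy; rewrite hx hy ltxx.
Qed.

Lemma le_a0_max (gamma : R) i : (0 < i <= n)%N ->
  a0_term n rho gamma i <= a0_max n rho gamma.
Proof.
by move=> i1n; apply: le_bigmax_seq; rewrite // mem_index_iota ltnS.
Qed.

Variable e : nat -> R.
Hypothesis e_ge0 : forall k, 0 <= e k.
(* Truncated subtraction: for [k < n] the term [e 0] occurs [n - k] times. *)
Hypothesis e_rec : forall k, e k.+1 <= rho / n%:R * \sum_(j < n) e (k - j)%N.

(** Strong induction: each window entry is [e 0] or at most [rho * e 0], so the window average is at
    most [e 0]. *)
Lemma window_contract k : e k.+1 <= rho * e 0.
Proof.
elim/ltn_ind: k => k IH; apply: le_trans (e_rec k) _.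
rewrite -mulrA ler_pM2l // mulrC ler_pdivrMr ?ltr0n //.
have -> : e 0 * n%:R = \sum_(j < n) e 0 by rewrite sumr_const card_ord mulr_natr.
apply: ler_sum => j _; case E: (k - j)%N => [//|m].
apply: le_trans (IH m _) _; last by rewrite ler_piMl // ltW.
by rewrite -E leq_subr.
Qed.

(** The window consists of [k] errors of positive index, bounded by [window_contract], and [n - k]
    copies of [e 0]. *)
Lemma window_initial k : (k < n)%N ->
  e k.+1 <= rho * (1 - k%:R * (1 - rho) / n%:R) * e 0.
Proof.
move=> kn; apply: le_trans (e_rec k) _.
have -> : rho * (1 - k%:R * (1 - rho) / n%:R) * e 0 =
    rho / n%:R * (k%:R * (rho * e 0) + (n - k)%:R * e 0).
  by rewrite natrB ?(ltnW kn) //; field; rewrite pnatr_eq0 -lt0n.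
rewrite ler_pM2l // -(big_mkord xpredT (fun j => e (k - j)%N)).
rewrite (@big_cat_nat _ _ _ k) ?(ltnW kn) //=; apply: lerD.
  rewrite mulr_natl -[k in X in _ <= X]subn0 -sumr_const_nat.
  rewrite !big_nat; apply: ler_sum => j /= jk.
  by rewrite -(subnSK jk); exact: window_contract.
rewrite mulr_natl -sumr_const_nat !big_nat; apply: ler_sum => j /andP[/eqP kj _].
by rewrite kj.
Qed.

Lemma window_rate (gamma : R) : 0 < gamma -> gamma < 1 -> rate_root n rho gamma ->
  forall k, e k.+1 <= a0_max n rho gamma * gamma ^+ k.+1 * e 0.
Proof.
move=> g0 g1 [_ _ /eqP]; rewrite rate_root_sum // => /eqP gE.
elim/ltn_ind => k IH; case: (ltnP k n) => [kn|nk].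
  apply: le_trans (window_initial _ kn) _; apply: ler_wpM2r => //.
  (* With [i = k.+1] in [a0_term], the factor [i - 1] is the [k] of [window_initial]. *)
  have := @le_a0_max gamma k.+1 kn.
  by rewrite /a0_term -(natrB _ (ltn0Sn k)) subn1 /= ler_pdivrMr ?exprn_gt0.
apply: le_trans (e_rec k) _.
(* The root equation times [gamma ^+ (k.+1 - n)], with the sum reversed. *)
have -> : gamma ^+ k.+1 = rho / n%:R * \sum_(j < n) gamma ^+ (k - j).
  rewrite -(subnK (leqW nk)) exprD gE mulrCA mulr_sumr; congr (_ * _).
  rewrite (reindex_inj rev_ord_inj) /=; apply: eq_bigr => j _.
  by rewrite -exprD; congr (_ ^+ _); have := ltn_ord j; lia.
rewrite [X in _ <= X](_ : _ = rho / n%:R *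
    \sum_(j < n) a0_max n rho gamma * gamma ^+ (k - j) * e 0).
  rewrite ler_pM2l //; apply: ler_sum => j _.
  (* The index [k - j] is positive, as the induction hypothesis requires: it says nothing about
     [e 0]. *)
  have kj : (j < k)%N := leq_trans (ltn_ord j) nk.
  by rewrite -(subnSK kj); apply: IH; rewrite ltn_subrL; lia.
by rewrite -mulr_suml -mulr_sumr; ring.
Qed.

End RateRoot.

(** * The stored points as a window of past iterates *)

Section Iterates.
Context {R : realType} {n p : nat}.
Variables (eps : R) (f : 'I_n -> 'rV[R]_p -> R) (x0 : 'rV[R]_p).
Hypothesis n_gt0 : (0 < n)%N.

Let x := diag_x eps f x0.
Let y := diag_y eps f x0.

Lemma diag_yS k (i : 'I_n) :
  y k.+1 i = if (i : nat) == (k %% n)%N then x k.+1 else y k i.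
Proof. by []. Qed.

Lemma diag_y_init k (i : 'I_n) : (k <= i)%N -> y k i = x 0.
Proof.
elim: k => // k IH ki; rewrite diag_yS modn_small ?gtn_eqF ?IH ?(ltnW ki) //.
exact: ltn_trans ki _.
Qed.

(** After step [k], component [i] is next refreshed at step [k + n]. *)
Lemma diag_y_recent k d (i : 'I_n) : i = (k %% n)%N :> nat -> (d < n)%N ->
  y (k.+1 + d) i = x k.+1.
Proof.
move=> ik; elim: d => [|d IH] dn; first by rewrite addn0 diag_yS ik eqxx.
rewrite addnS diag_yS IH ?(ltnW dn) // ik -[in (k %% n)%N](addn0 k) addSnnS.
by rewrite eqn_modDl mod0n modn_small.
Qed.

(** This component was refreshed [n] steps earlier, or never if [k < n]; the truncated subtraction
    then yields [x 0]. *)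
Lemma diag_y_oldest k (i : 'I_n) : i = (k %% n)%N :> nat ->
  y k i = x (k.+1 - n).
Proof.
case: (ltnP k n) => kn ik.
  rewrite (eqP (_ : k.+1 - n == 0)%N) ?subn_eq0 //.
  by apply: diag_y_init; rewrite ik modn_small.
rewrite subSn // -(@diag_y_recent (k - n) n.-1 i) ?prednK //; last first.
  by rewrite ik -{1}(subnK kn) modnDr.
by congr (y _ _); lia.
Qed.

(** Links the cyclic storage to the window recursion. Step [k] replaces the oldest value
    [x (k.+1 - n)] by [x k.+1], which is also how the window moves. *)
Lemma sum_diag_y (F : 'rV[R]_p -> R) k :
  \sum_(i < n) F (y k i) = \sum_(j < n) F (x (k - j)).
Proof.
elim: k => [|k IH]; first by apply: eq_bigr => j _.
pose i0 := Ordinal (ltn_pmod k n_gt0).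
rewrite (bigD1 i0) //= diag_yS eqxx.
rewrite (eq_bigr (fun i => F (y k i))) => [|i /negP ik]; last first.
  by rewrite diag_yS; case: eqP => // E; case: ik; apply/eqP; exact: val_inj.
move: IH; rewrite (bigD1 i0) //= (@diag_y_oldest k i0) //.
(* Writing [n] as [n.-1.+1] allows splitting the last term off the old window and the first off the
   new one; the other terms agree. *)
have -> (m : nat) : \sum_(j < n) F (x (m - j)) =
    \sum_(j < n.-1.+1) F (x (m - j)) by rewrite prednK.
have -> : \sum_(j < n) F (x (k.+1 - j)) =
    \sum_(j < n.-1.+1) F (x (k.+1 - j)) by rewrite prednK.
rewrite big_ord_recr [X in _ -> _ = X]big_ord_recl /=.
have -> : (k - n.-1 = k.+1 - n)%N by lia.
by rewrite addrC => /addIr ->.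
Qed.

End Iterates.

(** * Contraction of one aggregated step and the convergence rate *)

Lemma diag_step_contraction (R : realType) (n p : nat) (eps rho : R)
    (f : 'I_n -> 'rV[R]_p -> R) (xs : 'rV[R]_p) (y : 'I_n -> 'rV[R]_p) :
  (0 < n)%N -> \sum_(i < n) grad (f i) xs = 0 ->
  (forall i u v, enorm ((u - eps *: grad (f i) u) - (v - eps *: grad (f i) v))
     <= rho * enorm (u - v)) ->
  enorm (diag_step eps f y - xs) <= rho / n%:R * \sum_(i < n) enorm (y i - xs).
Proof.
move=> n0 gxs hf.
(* As the gradients at [xs] sum to 0, [xs] is the average of its own gradient steps. *)
have -> : diag_step eps f y - xs = n%:R^-1 *: \sum_(i < n)
    ((y i - eps *: grad (f i) (y i)) - (xs - eps *: grad (f i) xs)).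
  rewrite !sumrB -!scaler_sumr gxs scaler0 subr0 sumr_const card_ord !scalerBr.
  rewrite -(scaler_nat n xs) (scalerA _ n%:R) mulVf ?scale1r ?pnatr_eq0 -?lt0n //.
  by rewrite /diag_step scalerA (mulrC eps).
rewrite enormZ ?invr_ge0 ?ler0n // (mulrC rho) -mulrA ler_pM2l ?invr_gt0 ?ltr0n //.
rewrite mulr_sumr; apply: le_trans; first exact: enorm_sum.
by apply: ler_sum => i _; exact: hf.
Qed.

Theorem theorem7 (R : realType) (n p : nat) (mu L : R)
    (f : 'I_n -> 'rV[R]_p -> R) (xstar x0 : 'rV[R]_p)
    (hn : (1 <= n)%N) (hp : (1 <= p)%N)
    (hmu : 0 < mu) (hmuL : mu < L)
    (hdiff : forall i x, differentiable (f i) x)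
    (hsc : forall i, strongly_convex mu (f i))
    (hlip : forall i, lipschitz_grad L (f i))
    (hmin : is_minimizer (favg f) xstar) :
  let kappa := L / mu in
  let rho := (kappa - 1) / (kappa + 1) in
  let eps := 2 / (mu + L) in
  exists2 gamma0 : R, unique (rate_root n rho) gamma0 &
    forall k : nat, (1 <= k)%N ->
      enorm (diag_x eps f x0 k - xstar) <=
        a0_max n rho gamma0 * gamma0 ^+ k * enorm (x0 - xstar).
Proof.
move=> kappa rho eps.
have L0 : 0 < L := lt_trans hmu hmuL.
have S0 : 0 < L + mu by rewrite addr_gt0.
have rhoE : rho = (L - mu) / (L + mu).
  by rewrite /rho /kappa; field; rewrite !gt_eqF.
have rho_gt0 : 0 < rho by rewrite rhoE divr_gt0 // subr_gt0.
have rho_lt1 : rho < 1 by rewrite rhoE ltr_pdivrMr // mul1r; lra.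
have [gamma groot g0] := exists_rate_root n rho hn rho_gt0 rho_lt1.
exists gamma => // -[//|k] _; have [[_ g1 _] _] := groot.
pose e j := enorm (diag_x eps f x0 j - xstar).
apply: (@window_rate R n rho hn rho_gt0 rho_lt1 e) => //.
- by move=> j; exact: enorm_ge0.
(* The sum over the last [n] errors becomes a sum over the stored points, to which the one-step
   bound applies. *)
- move=> j; rewrite /e -(sum_diag_y eps f x0 hn (fun u => enorm (u - xstar))).
  apply: diag_step_contraction => //; first exact: grad_favg_minimizer.
  by move=> i u v; rewrite rhoE; exact: gradient_step_contraction.
- by case: groot.
Qed.
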